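(* (In $\mathrm{ZFC}$) $\mathrm{add}(\mathcal{NA})=\mathrm{non}(\mathcal{NA})$, where $\mathcal{NA}$ is the ideal of null-additive subsets of $2^\omega$.
   Context: The Cantor space $2^\omega$ is a topological group with coordinatewise addition modulo $2$. $\mathcal N$ is the ideal of Lebesgue null subsets of $2^\omega$. A set $X\subseteq 2^\omega$ is null-additive if $A+X\in\mathcal N$ for every $A\in\mathcal N$, where $A+X=\{a+x : a\in A,\ x\in X\}$. $\mathcal{NA}$ is the collection of null-additive subsets of $2^\omega$; it is a $\sigma$-ideal containing all singletons. For an ideal $\mathcal I$ of subsets of $2^\omega$ containing all singletons, $\mathrm{add}(\mathcal I)=\min\{|\mathcal J| : \mathcal J\subseteq\mathcal I,\ \bigcup\mathcal J\notin\mathcal I\}$ and $\mathrm{non}(\mathcal I)=\min\{|A| : A\subseteq 2^\omega,\ A\notin\mathcal I\}$. *)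

(* Defs.v *)
From mathcomp Require Import all_boot all_order all_algebra.
From mathcomp Require Import all_classical all_reals all_analysis.

Set Implicit Arguments.
Unset Strict Implicit.
Unset Printing Implicit Defensive.

Import Order.TTheory GRing.Theory Num.Theory.

Local Open Scope classical_set_scope.
Local Open Scope ring_scope.

Definition cantor_add (x y : cantor_space) : cantor_space :=
  fun n => x n (+) y n.

Definition cantor_sumset (A X : set cantor_space) : set cantor_space :=
  [set cantor_add a x | a in A & x in X].

(* The basic clopen set of all infinite extensions of s. *)
Definition cylinder (s : seq bool) : set cantor_space :=
  [set x | mkseq x (size s) = s].

(* The Lebesgue (coin-tossing, Haar) outer measure: [cylinder s] has measure
   2^-(size s). Always using infinite sequences of cylinders loses nothing,
   since a finite cover can be padded with arbitrarily small cylinders. *)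
Definition cantor_outer_measure (R : realType) (A : set cantor_space) : \bar R :=
  ereal_inf [set (\sum_(0 <= k <oo) ((2 ^- size (s k))%:E : \bar R))%E
            | s in [set s : nat -> seq bool |
                     A `<=` \bigcup_k cylinder (s k)]].

Definition null_ideal (R : realType) : set (set cantor_space) :=
  [set A | cantor_outer_measure R A = 0%E].

Definition null_additive (R : realType) : set (set cantor_space) :=
  [set X | forall A, null_ideal R A -> null_ideal R (cantor_sumset A X)].

(* A cardinal is given by a set representing it, up to equipotence [#=]:
   [is_min_card F A] says that |A| = min {|B| : B in F}. *)
Definition is_min_card (T : Type) (F : set (set T)) (A : set T) : Prop :=
  F A /\ forall B, F B -> (A #<= B)%card.

(* |J| = add(I) *)
Definition is_add (T : Type) (I : set (set T)) (J : set (set T)) : Prop :=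
  is_min_card [set K : set (set T) | K `<=` I /\ ~ I (\bigcup_(X in K) X)] J.

(* |A| = non(I) *)
Definition is_non (T : Type) (I : set (set T)) (A : set T) : Prop :=
  is_min_card [set B : set T | ~ I B] A.

(* Main.v *)
Require Import Defs.
From HB Require Import structures.
From mathcomp Require Import all_boot all_order all_algebra.
From mathcomp Require Import all_classical all_reals all_analysis.
From mathcomp Require Import zify ring.

(** Singletons are null-additive and the whole space is not, so a minimal set
that is not null-additive exists, and the singletons of its points witness
[add <= non]. The content is [non <= add], which rests on Shelah's
combinatorial description of null-additivity.

Call [X] narrow for [h] and [f] when, for all large [n], its points have at
most [h n] different restrictions to the first [f n] coordinates, and
sigma-narrow when it is covered by countably many narrow pieces. The
description is: [X] is null-additive if and only if, for a slow [h] which does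
not depend on [f], [X] is sigma-narrow for every [f]. The bound [h] is allowed
to differ in the two directions, and this slack is what proves the theorem.

- If [X] is sigma-narrow for all [f], for whatever [h], then [X] is
  null-additive ([sigma_narrow_null_additive]): a null set [A] is covered by
  finite blocks of cylinders, the [n]-th one of weight at most [2^-n / h n]; if
  [f n] bounds the lengths used in that block, a translation by [x] moves it in
  a way that only depends on the first [f n] coordinates of [x], so a narrow
  piece multiplies its measure by at most [h n].

- If [X] is null-additive, it is sigma-narrow with [h n = 2^n] for every [f]
  ([null_additive_sigma_narrow]). Let [zero_block g n] be the set of the [y]
  which have [n] zeros in a window whose address is an injective function of
  the first [g n] coordinates of [y]. It has measure [2^-n], so the set [A] of
  the points in infinitely many of these blocks is null. As [A + X] is null, it
  misses a closed set of positive measure, and a Baire category argument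
  ([avoids_zero_blocks_somewhere]) cuts [X] into countably many pieces such
  that the translates of all late blocks by the points of a piece miss one
  common set [E] of positive measure. If a piece had [2^n] different
  restrictions to [g n] coordinates, then inside any cylinder of length [g n]
  the corresponding translates would test pairwise disjoint windows, hence be
  independent, and [E] would fill at most [(1 - 2^-n)^(2^n) <= 1/2] of the
  cylinder. By a density argument ([null_of_half_density]) this cannot happen
  for infinitely many [n].

Now let [K] be a family of null-additive sets with fewer members than any set
that is not null-additive, and fix [f]. Cut each [X] in [K] into pieces that
are narrow for [2^n] and [f], and code the trees of all these pieces by one
point of the Cantor space ([tree_code]). The set of codes is too small not to
be null-additive, so it is itself sigma-narrow, for a function [g] such that
the first [g n] bits of a code determine the level [f n] of the first [n]
trees. Grouping the members of [K] according to the piece containing their code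
gives countably many pieces of the union with at most [2^n * 2^n] restrictions
([bigcup_sigma_narrow]); hence the union is null-additive. *)

Set Implicit Arguments.
Unset Strict Implicit.
Unset Printing Implicit Defensive.

Import Order.TTheory GRing.Theory Num.Theory.

Local Open Scope classical_set_scope.
Local Open Scope ring_scope.

(** * Initial segments and cylinders *)

Lemma cylinderP s x : cylinder s x <->
  forall i, (i < size s)%N -> x i = nth false s i.
Proof.
split=> [<- i|H]; first by rewrite size_mkseq => ?; rewrite nth_mkseq.
apply: (@eq_from_nth _ false); rewrite size_mkseq// => i il.
by rewrite nth_mkseq// H.
Qed.

Lemma cylinder_cat s t x : cylinder (s ++ t) x <->
  cylinder s x /\ forall j, (j < size t)%N -> x (size s + j)%N = nth false t j.
Proof.
rewrite !cylinderP; split=> [H|[Hs Ht] i].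
  split=> [i il|j jl].
    by rewrite H ?nth_cat ?il// size_cat ltn_addr.
  by rewrite H ?size_cat ?ltn_add2l// nth_cat ltnNge leq_addr /= addKn.
rewrite size_cat nth_cat => il; case: ltnP => [/Hs//|si].
by rewrite -Ht ?subnKC// ltn_subLR.
Qed.

Lemma cylinder_mkseq x n : cylinder (mkseq x n) x.
Proof. by rewrite /cylinder/= size_mkseq. Qed.

Lemma cylinder_nil : cylinder [::] = setT.
Proof. by apply/seteqP; split. Qed.

Lemma cylinder_rcons_mkseq s x :
  cylinder s x -> cylinder (rcons s (x (size s))) x.
Proof.
by rewrite -cats1 => sx; apply/cylinder_cat; split=> // -[|//] _; rewrite addn0.
Qed.

Lemma cylinder_prefix s t : prefix s t -> cylinder t `<=` cylinder s.
Proof. by move=> /prefixP[u ->] x /cylinder_cat[]. Qed.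

Lemma mkseq_take x m n : (m <= n)%N ->
  mkseq x m = take m (mkseq x n) :> seq bool.
Proof. by move=> mn; rewrite /mkseq -map_take take_iota (minn_idPl mn). Qed.

Lemma prefix_cylinder s x n : cylinder s x -> (size s <= n)%N ->
  prefix s (mkseq x n).
Proof. by move=> sx sn; rewrite -sx (mkseq_take _ sn) prefix_take. Qed.

Lemma cylinder_chain (s : nat -> seq bool) :
  (forall j, prefix (s j) (s j.+1)) -> (forall j, (j <= size (s j))%N) ->
  exists z, forall j, cylinder (s j) z.
Proof.
move=> sS sj; have mono : {homo s : i j / (i <= j)%N >-> prefix i j}.
  apply: homo_leq => //; first exact: prefix_refl.
  by move=> ? ? ?; exact: prefix_trans.
exists (fun i => nth false (s i.+1) i) => j; apply/cylinderP => i il.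
have [ij|ji] := leqP i.+1 j.
  have /prefixP[t ->] := mono _ _ ij.
  by rewrite nth_cat (sj i.+1).
have /prefixP[t ->] := mono _ _ (ltnW ji).
by rewrite nth_cat il.
Qed.

Definition seq_add (s t : seq bool) :=
  mkseq (fun i => nth false s i (+) nth false t i) (size s).

Lemma seq_add_inj p q q' : size q = size p -> size q' = size p ->
  seq_add p q = seq_add p q' -> q = q'.
Proof.
move=> sq sq' eq; apply: (@eq_from_nth _ false); rewrite sq ?sq'// => i ip.
have := congr1 (fun s => nth false s i) eq.
by rewrite !nth_mkseq// => /addbI.
Qed.

Lemma mkseq_cantor_add x y n :
  mkseq (cantor_add x y) n = seq_add (mkseq x n) (mkseq y n).
Proof.
apply: (@eq_from_nth _ false); rewrite !size_mkseq// => i il.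
by rewrite !nth_mkseq ?size_mkseq// !nth_mkseq.
Qed.

Lemma cylinder_add s a x n : (size s <= n)%N -> cylinder s a ->
  cylinder (seq_add s (mkseq x n)) (cantor_add a x).
Proof.
move=> sn /cylinderP sa; apply/cylinderP => i; rewrite size_mkseq => il.
by rewrite nth_mkseq// nth_mkseq ?(leq_trans il)// -sa.
Qed.

Lemma cantor_addK a x : cantor_add (cantor_add a x) x = a.
Proof. by apply/funext => n; rewrite /cantor_add -addbA addbb addbF. Qed.

(** * The coin-tossing outer measure *)

Section CantorMeasure.
Variable R : realType.
Local Notation mu := (cantor_outer_measure R).

Definition weight (s : seq bool) : \bar R := (2 ^- size s)%:E.

Lemma weight_ge0 s : (0 <= weight s)%E.
Proof. by rewrite lee_fin invr_ge0 exprn_ge0. Qed.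

Lemma exp2N_small (e : R) : 0 < e -> exists N, 2 ^- N <= e.
Proof.
move=> e0; have /cvgrPdist_lt/(_ _ e0)[N _ /(_ N (leqnn _))] :
    (fun n => geometric 1 (2^-1 : R) n) @ \oo --> 0.
  by apply: cvg_geometric; rewrite gtr0_norm ?invf_lt1 ?ltr1n.
rewrite sub0r normrN /= mul1r exprVn gtr0_norm ?invr_gt0 ?exprn_gt0//.
by exists N; exact: ltW.
Qed.

Lemma exp2N_split n : (2 ^- n : R) = 2 ^- n.+1 + 2 ^- n.+1.
Proof. by rewrite exprS; field. Qed.

Lemma cantor_measure_le A s : A `<=` \bigcup_k cylinder (s k) ->
  (mu A <= \sum_(0 <= k <oo) weight (s k))%E.
Proof. by move=> As; apply: ereal_inf_lbound; exists s. Qed.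

Lemma cantor_measure_lt A x : (mu A < x)%E ->
  exists2 s, A `<=` \bigcup_k cylinder (s k) &
             (\sum_(0 <= k <oo) weight (s k) < x)%E.
Proof. by move=> /ereal_inf_lt[_ [s As <-] lt]; exists s. Qed.

Lemma cantor_measure_ge0 A : (0 <= mu A)%E.
Proof.
apply: le_ereal_inf_tmp => _ [s _ <-]; apply: nneseries_ge0 => k _ _.
exact: weight_ge0.
Qed.

Lemma cantor_measure_le_mono : {homo mu : A B / A `<=` B >-> (A <= B)%E}.
Proof.
move=> A B AB; apply: ereal_inf_le_tmp => _ [s Bs <-]; exists s => //.
exact: subset_trans AB Bs.
Qed.

(** The cover must be infinite, so a single cylinder is completed by cylinders
of arbitrarily small total weight. *)
Lemma cantor_measure_cylinder s : (mu (cylinder s) <= weight s)%E.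
Proof.
apply/lee_addgt0Pr => e e0.
have [N Ne] := exp2N_small e0.
pose c k := if k is 0%N then s else nseq (N + k.+1) false.
apply: le_trans (cantor_measure_le (s := c) _) _.
  by move=> x sx; exists 0%N.
pose a k := if k is 0%N then weight s else 0%E.
have a0 k : (0 <= a k)%E by case: k => //=; exact: weight_ge0.
rewrite (_ : weight s = \sum_(0 <= k <oo) a k)%E; last first.
  rewrite nneseries_recl//= eseries0 ?adde0// => -[]//.
apply: le_trans (epsilon_trick xpredT a0 (ltW e0)).
apply: lee_nneseries => [k _ _|[|k] _]; first exact: weight_ge0.
  by rewrite /= leeDl// lee_fin divr_ge0// ?ltW// ltr0n expn_gt0.
rewrite /= add0e lee_fin size_nseq exprD invfM natrX.
by rewrite ler_pM ?invr_ge0 ?exprn_ge0.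
Qed.

Lemma cantor_measure0 : mu set0 = 0%E.
Proof.
apply/eqP; rewrite eq_le cantor_measure_ge0 andbT.
apply/lee_addgt0Pr => e e0; rewrite add0e; have [N Ne] := exp2N_small e0.
apply: le_trans (_ : weight (nseq N false) <= _)%E.
  apply: le_trans (cantor_measure_cylinder _).
  exact: cantor_measure_le_mono.
by rewrite lee_fin size_nseq.
Qed.

Lemma cantor_measure_sigma_subadditive : sigma_subadditive mu.
Proof.
move=> A; have [[i ioo]|Aoo] :=
    pselect (exists i, mu (A i) = +oo%E).
  rewrite (eseries_pinfty _ _ ioo) ?leey// => n _.
  by rewrite -ltNye (lt_le_trans _ (cantor_measure_ge0 _)).
apply/lee_addgt0Pr => e e0.
have A0 n : (0 <= mu (A n))%E := cantor_measure_ge0 (A n).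
apply: le_trans (epsilon_trick xpredT A0 (ltW e0)).
have cover n : exists s, A n `<=` \bigcup_k cylinder (s k) /\
    (\sum_(0 <= k <oo) weight (s k) <= mu (A n) + (e / (2 ^ n.+1)%:R)%:E)%E.
  have : (mu (A n) < mu (A n) + (e / (2 ^ n.+1)%:R)%:E)%E.
    rewrite lteDl ?lte_fin ?divr_gt0 ?ltr0n ?expn_gt0//.
    rewrite ge0_fin_numE ?cantor_measure_ge0// ltey.
    by apply/negP => /eqP Aoo'; apply: Aoo; exists n.
  by move=> /cantor_measure_lt[s As /ltW ?]; exists s.
have [G GP] := choice cover.
(* The covers of the [A n] are merged along a bijection of [nat] with
   [nat * nat]. *)
have /card_esym/ppcard_eqP[f] := card_nat2.
apply: le_trans (cantor_measure_le (s := uncurry G \o f) _) _.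
  move=> x [n _ /(GP n).1[k _ xk]].
  by exists (f^-1%FUN (n, k)) => //=; rewrite invK ?inE.
rewrite nneseries_esumT; last by move=> k; exact: weight_ge0.
rewrite -(@reindex_esum _ _ _ setT setT f (weight \o uncurry G)); last first.
  exact: bij.
rewrite (eq_esum (b := fun k => weight (G k.1 k.2))); last by case.
rewrite (_ : [set: nat * nat] = [set: nat] `*`` (fun=> [set: nat])); last first.
  by apply/seteqP; split.
rewrite -(@esum_esum _ _ _ _ _ (fun i j => weight (G i j))); last first.
  by move=> *; exact: weight_ge0.
rewrite nneseries_esumT; last first.
  by move=> n; rewrite adde_ge0 ?cantor_measure_ge0// lee_fin divr_ge0// ltW.
apply: le_esum => n _; rewrite -nneseries_esumT; first exact: (GP n).2.
by move=> k; exact: weight_ge0.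
Qed.

HB.instance Definition _ := isOuterMeasure.Build R cantor_space mu
  cantor_measure0 cantor_measure_ge0 cantor_measure_le_mono
  cantor_measure_sigma_subadditive.

(** The measure of [cylinder s `&` cylinder p]: two cylinders are nested or
disjoint. *)
Definition meet_weight (s p : seq bool) : \bar R :=
  if prefix s p || prefix p s then (2 ^- maxn (size s) (size p))%:E else 0%E.

Lemma meet_weight_ge0 s p : (0 <= meet_weight s p)%E.
Proof.
by rewrite /meet_weight; case: ifP => // _; rewrite lee_fin invr_ge0 exprn_ge0.
Qed.

Lemma meet_weight_cons c s d p : meet_weight (c :: s) (d :: p) =
  if c == d then ((2^-1)%:E * meet_weight s p)%E else 0%E.
Proof.
rewrite /meet_weight !prefix_cons [d == c]eq_sym; case: eqP => //= _.
case: ifP => // _; last by rewrite mule0.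
by rewrite maxnSS -EFinM exprS invfM.
Qed.

Lemma meet_weight_split s p : (meet_weight s p =
  meet_weight s (rcons p false) + meet_weight s (rcons p true))%E.
Proof.
elim: p s => [|d p IHp] [|c s].
- by rewrite /meet_weight /= -EFinD -exp2N_split.
- rewrite /= !meet_weight_cons /meet_weight /= prefix0s orbT !maxn0.
  by case: c; rewrite /= ?add0e ?adde0 -EFinM exprS invfM.
- by rewrite /meet_weight /= !max0n !size_rcons -EFinD -exp2N_split.
rewrite !rcons_cons !meet_weight_cons; case: eqP => // _; last by rewrite adde0.
by rewrite -ge0_muleDr ?meet_weight_ge0// -IHp.
Qed.

(** If a cover had total weight less than 1, then one of the two halves of any
cylinder in which the cover has less than full weight would again have this
property. Following such halves gives a point outside of the cover, since
inside a member of the cover the weight is full. *)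
Lemma cantor_measureT : (1 <= mu setT)%E.
Proof.
apply: le_ereal_inf_tmp => _ [s cov <-].
rewrite leNgt; apply/negP => lt1.
pose F p := (\sum_(0 <= k <oo) meet_weight (s k) p)%E.
have F_split p : F p = (F (rcons p false) + F (rcons p true))%E.
  rewrite /F -nneseriesD//; first last.
  - by move=> k _ _; exact: meet_weight_ge0.
  - by move=> k _ _; exact: meet_weight_ge0.
  by apply: eq_eseriesr => k _; exact: meet_weight_split.
pose small p := is_true (F p < weight p)%E.
have step (p : sig small) : exists q : sig small,
    exists b, sval q = rcons (sval p) b.
  case: p => p Fp /=; apply: contrapT => H.
  have Fb b : (weight (rcons p b) <= F (rcons p b))%E.
    rewrite leNgt; apply/negP => lt; apply: H.
    by exists (exist _ (rcons p b) lt); exists b.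
  move: Fp; rewrite /small ltNge F_split => /negP; apply.
  apply: le_trans (leeD (Fb false) (Fb true)).
  by rewrite -EFinD lee_fin !size_rcons -exp2N_split.
have [next nextP] := choice step.
have F0 : small [::].
  rewrite /small /weight /= expr0 invr1; apply: le_lt_trans lt1.
  rewrite le_eqVlt; apply/orP; left; apply/eqP; apply: eq_eseriesr => k _.
  by rewrite /meet_weight prefix0s orbT maxn0.
pose p n := sval (iter n next (exist small _ F0)).
have size_p n : size (p n) = n.
  elim: n => //= n IHn; rewrite /p iterS.
  have [b ->] := nextP (iter n next (exist small _ F0)).
  by rewrite size_rcons IHn.
have [x xp] : exists x, forall n, cylinder (p n) x.
  apply: cylinder_chain => n; last by rewrite size_p.
  rewrite /p iterS; have [b ->] := nextP (iter n next (exist small _ F0)).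
  exact: prefix_rcons.
have [k _ xk] := cov x I.
have : (F (p (size (s k))) < weight (p (size (s k))))%E.
  exact: (svalP (iter (size (s k)) next (exist small _ F0))).
have -> : p (size (s k)) = s k by rewrite -(xp (size (s k))) size_p.
rewrite ltNge => /negP; apply.
apply: le_trans (_ : meet_weight (s k) (s k) <= _)%E.
  by rewrite /meet_weight prefix_refl maxnn.
rewrite /F (@nneseriesD1 _ _ k)//; last by move=> *; exact: meet_weight_ge0.
rewrite leeDl// nneseries_ge0// => *; exact: meet_weight_ge0.
Qed.

End CantorMeasure.

(** * Null sets and relative measure *)

Section NullSets.
Variable R : realType.
Local Notation mu := (cantor_outer_measure R).
Local Notation weight := (@weight R).

Lemma null_subset A B : A `<=` B -> mu B = 0%E -> mu A = 0%E.
Proof.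
move=> AB B0; apply/eqP; rewrite eq_le outer_measure_ge0 andbT -B0.
exact: le_outer_measure.
Qed.

Lemma null_setU A B : mu A = 0%E -> mu B = 0%E -> mu (A `|` B) = 0%E.
Proof.
move=> A0 B0; apply/eqP; rewrite eq_le outer_measure_ge0 andbT.
apply: (@le_trans _ _ (mu A + mu B)%E); first exact: outer_measureU2.
by rewrite A0 B0 adde0.
Qed.

Lemma null_bigcup (I : countType) (B : I -> set cantor_space) :
  (forall i, mu (B i) = 0%E) -> mu (\bigcup_i B i) = 0%E.
Proof.
move=> B0; pose B' n := if unpickle n is Some i then B i else set0.
apply: (@null_subset _ (\bigcup_n B' n)) => [x [i _ Bix]|].
  by exists (pickle i); rewrite // /B' pickleK.
apply/eqP; rewrite eq_le outer_measure_ge0 andbT.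
apply: le_trans (outer_measure_sigma_subadditive _ _) _.
by rewrite eseries0// => n _ _; rewrite /B'; case: unpickle => // i; exact: B0.
Qed.

Lemma le_exp2N_null A : (forall n, mu A <= (2 ^- n)%:E)%E -> mu A = 0%E.
Proof.
move=> An; apply/eqP; rewrite eq_le outer_measure_ge0 andbT.
apply/lee_addgt0Pr => e /exp2N_small[N Ne]; rewrite add0e.
by apply: le_trans (An N) _; rewrite lee_fin.
Qed.

Lemma bigcup_exp2N_le (B : nat -> set cantor_space) N :
  (forall n, mu (B n) <= (2 ^- (N + n).+1)%:E)%E ->
  (mu (\bigcup_n B n) <= (2 ^- N)%:E)%E.
Proof.
move=> BN; apply: le_trans (outer_measure_sigma_subadditive _ _) _.
have N0 : 0 <= 2 ^- N :> R by rewrite invr_ge0 exprn_ge0.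
apply: le_trans (epsilon_trick0 xpredT N0).
apply: lee_nneseries => [n _ _|n _]; first exact: outer_measure_ge0.
by rewrite (le_trans (BN n))// -addnS exprD invfM natrX.
Qed.

Lemma null_limsup A (B : nat -> set cantor_space) :
  (forall n, mu (B n) <= (2 ^- n)%:E)%E ->
  (forall x, A x -> forall N, exists2 n, (N <= n)%N & B n x) -> mu A = 0%E.
Proof.
move=> Bn AB; apply: le_exp2N_null => N.
apply: le_trans (bigcup_exp2N_le (B := fun n => B (N + n).+1) _) => //.
apply: le_outer_measure => x /AB/(_ N.+1)[n Nn Bnx].
by exists (n - N.+1)%N; rewrite // -addSn subnKC.
Qed.

Lemma cantor_measure_seq_sum (I : eqType) (r : seq I)
    (B : I -> set cantor_space) :
  (mu [set x | exists2 i, i \in r & B i x] <= \sum_(i <- r) mu (B i))%E.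
Proof.
elim: r => [|i r IH].
  rewrite big_nil (_ : [set _ | _] = set0) ?outer_measure0//.
  by apply/seteqP; split=> // x [].
rewrite big_cons; apply: le_trans (leeD (lexx _) IH).
apply: le_trans (outer_measureU2 _ _ _); apply: le_outer_measure => x [j].
by rewrite inE => /predU1P[->|jr] Bx; [left|right; exists j].
Qed.

Lemma cantor_measure_seq_const (I : eqType) (r : seq I)
    (B : I -> set cantor_space) (c : R) :
  (forall i, i \in r -> mu (B i) <= c%:E)%E ->
  (mu [set x | exists2 i, i \in r & B i x] <= ((size r)%:R * c)%:E)%E.
Proof.
move=> Bc; apply: le_trans (cantor_measure_seq_sum _ _) _.
elim: r Bc => [|i r IH] Bc; first by rewrite big_nil mul0r.
rewrite big_cons [size _]/= -natr1 mulrDl mul1r EFinD [leRHS]addeC; apply: leeD.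
  by apply: Bc; rewrite mem_head.
by apply: IH => j jr; apply: Bc; rewrite inE jr orbT.
Qed.

Lemma cantor_measure_split B p : (mu (B `&` cylinder p) <=
  mu (B `&` cylinder (rcons p false)) + mu (B `&` cylinder (rcons p true)))%E.
Proof.
apply: le_trans (outer_measureU2 _ _ _); apply: le_outer_measure => x [Bx].
by move=> /cylinder_rcons_mkseq; case: (x _); [right|left].
Qed.

Lemma weight_rcons p b : weight (rcons p b) = (2^-1 * 2 ^- size p)%:E.
Proof. by rewrite /weight size_rcons exprS invfM. Qed.

Lemma relative_bound (B : set cantor_space) (c : R) p d :
  (forall t, size t = d ->
    mu (B `&` cylinder (p ++ t)) <= c%:E * weight (p ++ t))%E ->
  (mu (B `&` cylinder p) <= c%:E * weight p)%E.
Proof.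
elim: d p => [|d IHd] p H; first by have := H [::] erefl; rewrite cats0.
have Hb b : (mu (B `&` cylinder (rcons p b)) <= c%:E * weight (rcons p b))%E.
  by apply: IHd => t td; rewrite cat_rcons; apply: H; rewrite /= td.
apply: le_trans (cantor_measure_split _ _) _.
apply: le_trans (leeD (Hb false) (Hb true)) _.
rewrite !weight_rcons -!EFinM -EFinD lee_fin le_eqVlt.
by apply/orP; left; apply/eqP; field.
Qed.

(** Among the [2^|v|] extensions of [p] by [|v|] bits, one is lost. *)
Lemma relative_bound_avoid (B : set cantor_space) (c : R) p v :
  (forall t, size t = size v ->
    mu (B `&` cylinder (p ++ t)) <= c%:E * weight (p ++ t))%E ->
  B `&` cylinder (p ++ v) = set0 ->
  (mu (B `&` cylinder p) <= (c * (1 - 2 ^- size v))%:E * weight p)%E.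
Proof.
elim: v p => [|b v IHv] p H Bv.
  rewrite cats0 in Bv; rewrite Bv outer_measure0.
  by rewrite expr0 invr1 subrr mulr0 mul0e.
have Hb b' : (mu (B `&` cylinder (rcons p b')) <= c%:E * weight (rcons p b'))%E.
  by apply: (@relative_bound _ _ _ (size v)) => t td; rewrite cat_rcons H//= td.
have Hv : (mu (B `&` cylinder (rcons p b)) <=
    (c * (1 - 2 ^- size v))%:E * weight (rcons p b))%E.
  by apply: IHv => [t td|]; rewrite cat_rcons// H//= td.
apply: le_trans (cantor_measure_split _ _) _.
have -> : ((c * (1 - 2 ^- size (b :: v)))%:E * weight p =
    (c * (1 - 2 ^- size v))%:E * weight (rcons p b) +
    c%:E * weight (rcons p (~~ b)))%E.
  rewrite !weight_rcons -!EFinM -EFinD /= exprS invfM; congr EFin; field.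
  by rewrite !lt0r_neq0 ?exprn_gt0.
by case: b Hv {Bv H IHv} => Hv /=; [rewrite addeC|]; apply: leeD.
Qed.

(** Independence of disjoint windows: each window of [n] bits in which one
pattern is forbidden costs a factor [1 - 2^-n], provided that the windows start
beyond [p] and do not overlap. *)
Lemma relative_bound_windows (B : set cantor_space) n (addrs : seq nat) p :
  sorted (fun a b => a + n <= b)%N addrs ->
  (forall a, a \in addrs -> (size p <= a)%N) ->
  (forall a, a \in addrs -> exists x : cantor_space,
     forall y, B y -> ~ forall j, (j < n)%N -> y (a + j)%N = x (a + j)%N) ->
  (mu (B `&` cylinder p) <= ((1 - 2 ^- n) ^+ size addrs)%:E * weight p)%E.
Proof.
elim: addrs p => [|a addrs IH] p.
  move=> _ _ _; rewrite expr0 mul1e.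
  apply: le_trans (cantor_measure_cylinder _ _).
  by apply: le_outer_measure; exact: subIsetr.
move=> ord pa avoid; apply: (@relative_bound _ _ _ (a - size p)) => t ta.
have sz : size (p ++ t) = a by rewrite size_cat ta subnKC// pa// mem_head.
have [x Bx] := avoid a (mem_head _ _).
(* [v] is the forbidden pattern of the first window. *)
pose v := mkseq (fun j => x (a + j)%N) n.
have -> : n = size v by rewrite size_mkseq.
rewrite [size (_ :: _)]/= exprSr; apply: relative_bound_avoid.
  rewrite size_mkseq => u un; apply: IH.
  - exact: path_sorted ord.
  - move=> a' a'in; rewrite size_cat sz un.
    have tr : transitive (fun a b => a + n <= b)%N.
      by move=> ? ? ? h1 h2; exact: leq_trans h1 (leq_trans (leq_addr _ _) h2).
    by have /allP := order_path_min tr ord; apply.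
  - by move=> a' a'in; apply: avoid; rewrite inE a'in orbT.
apply/seteqP; split=> // y [/Bx nxy] /cylinder_cat[_ yv]; apply: nxy => j jn.
by rewrite -{1}sz yv ?size_mkseq// nth_mkseq.
Qed.

(** An instance of Lebesgue's density theorem. A bound on all cylinders of
arbitrarily large lengths extends to all cylinders; applied to the members of a
cover of [E] of nearly optimal weight, it halves the measure of [E]. *)
Lemma null_of_half_density (E : set cantor_space) :
  (forall N, exists2 l, (N <= l)%N &
    forall p, size p = l -> mu (E `&` cylinder p) <= (2^-1)%:E * weight p)%E ->
  mu E = 0%E.
Proof.
move=> H; have half p : (mu (E `&` cylinder p) <= (2^-1)%:E * weight p)%E.
  have [l pl lP] := H (size p).
  apply: (@relative_bound _ _ _ (l - size p)) => t tl.
  by apply: lP; rewrite size_cat tl subnKC.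
have E1 : (mu E <= 1)%E.
  apply: le_trans (_ : weight [::] <= _)%E; last by rewrite /weight expr0 invr1.
  apply: le_trans (cantor_measure_cylinder _ _).
  by rewrite cylinder_nil; exact: le_outer_measure.
apply/eqP; rewrite eq_le outer_measure_ge0 andbT leNgt; apply/negP => E0.
have Efin : mu E \is a fin_num.
  by rewrite ge0_fin_numE ?outer_measure_ge0// (le_lt_trans E1)// ltry.
have : (mu E < mu E + mu E)%E by rewrite lteDl.
move=> /cantor_measure_lt[s Es]; apply/negP; rewrite -leNgt.
have -> : (mu E + mu E = 2%:E * mu E)%E.
  by rewrite -(fineK Efin) -EFinD -EFinM mulr_natl.
rewrite -lee_pdivlMl ?ltr0n// -nneseriesZl; last by move=> *; exact: weight_ge0.
apply: le_trans (_ : \sum_(0 <= k <oo) mu (E `&` cylinder (s k)) <= _)%E.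
  apply: le_trans (outer_measure_sigma_subadditive _ _).
  by apply: le_outer_measure => x Ex; have [k _ xk] := Es x Ex; exists k.
by apply: lee_nneseries => // k _ _; exact: outer_measure_ge0.
Qed.

End NullSets.

(** * Narrow sets are null-additive *)

Definition narrow (h f : nat -> nat) (X : set cantor_space) :=
  exists m, forall n, (m <= n)%N -> exists S : seq (seq bool),
    (size S <= h n)%N /\ forall x, X x -> mkseq x (f n) \in S.

Definition sigma_narrow (h f : nat -> nat) (X : set cantor_space) :=
  exists2 P : nat -> set cantor_space,
    X `<=` \bigcup_p P p & forall p, narrow h f (P p).

Lemma narrow_le h f g X : (forall n, (f n <= g n)%N) ->
  narrow h g X -> narrow h f X.
Proof.
move=> fg [m mP]; exists m => n /mP[S [Sn XS]].
exists [seq take (f n) s | s <- S]; rewrite size_map; split=> // x /XS xS.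
by rewrite (mkseq_take _ (fg n)) map_f.
Qed.

Lemma sigma_narrow_countable (I : countType) h f (P : I -> set cantor_space) X :
  X `<=` \bigcup_i P i -> (forall i, narrow h f (P i)) -> sigma_narrow h f X.
Proof.
move=> XP Pn; exists (fun n => if unpickle n is Some i then P i else set0).
  by move=> x /XP[i _ Px]; exists (pickle i); rewrite // pickleK.
by move=> n; case: unpickle => // ; exists 0%N => k _; exists [::].
Qed.

Section NarrowNullAdditive.
Variable R : realType.
Local Notation mu := (cantor_outer_measure R).
Local Notation weight := (@weight R).

(** A cover by cylinders of finite total weight is cut at indices beyond which
the tails of the series are as small as prescribed. *)
Lemma null_cover_blocks A (d : nat -> R) : (forall n, 0 < d n) -> mu A = 0%E ->
  exists L : nat -> seq (seq bool),
    (forall x, A x -> exists n, exists2 s, s \in L n & cylinder s x) /\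
    (forall n, \sum_(s <- L n) weight s <= (d n)%:E)%E.
Proof.
move=> d0 A0.
have : (mu A < (d 0%N)%:E)%E by rewrite A0 lte_fin.
move=> /cantor_measure_lt[s As sd].
pose T N := (\sum_(N <= k <oo) weight (s k))%E.
have T_split N j : (T N = \sum_(N <= k < N + j) weight (s k) + T (N + j)%N)%E.
  by apply: nneseries_split => *; exact: weight_ge0.
have T_ge0 N : (0 <= T N)%E by apply: nneseries_ge0 => *; exact: weight_ge0.
have tail n : exists N, (n = 0 -> N = 0)%N /\ (T N <= (d n)%:E)%E.
  case: n => [|n]; first by exists 0%N; split=> //; exact: ltW.
  have /fine_cvgP[fin /cvgrPdist_le/(_ _ (d0 n.+1))[N2 _ N2P]] :
      (T N @[N --> \oo] --> 0)%E.
    apply: nneseries_tail_cvg => [|k _]; last exact: weight_ge0.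
    by rewrite (lt_trans sd)// ltry.
  case: fin => N1 _ N1P; pose N := maxn N1 N2; exists N; split=> //.
  have fN : T N \is a fin_num by apply: N1P; rewrite /= leq_maxl.
  rewrite -(fineK fN) lee_fin.
  have := N2P N; rewrite /= sub0r normrN => /(_ (leq_maxr _ _)).
  exact: le_trans (ler_norm _).
have [N NP] := choice tail.
(* Increasing cut points beyond the chosen tails, starting at 0 so that no
   member of the cover is lost. *)
pose M n := (\sum_(i < n.+1) N i + n)%N.
have M0 : M 0%N = 0%N by rewrite /M big_ord1 addn0; exact: (NP 0%N).1.
have NM n : (N n <= M n)%N by rewrite /M big_ord_recr /=; lia.
have MS n : (M n < M n.+1)%N.
  by rewrite /M [X in (_ < X + _)%N]big_ord_recr /=; lia.
exists (fun n => [seq s k | k <- index_iota (M n) (M n.+1)]); split=> [x /As|n].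
  move=> [k _ xk].
  have ex : exists n, (k < M n.+1)%N.
    by exists k; apply: leq_ltn_trans (MS k); rewrite /M leq_addl.
  case: (ex_minnP ex) => n kn nmin; exists n, (s k) => //.
  apply: map_f; rewrite mem_index_iota kn andbT.
  case: n kn nmin => [|n] _ nmin; first by rewrite M0.
  by rewrite leqNgt; apply/negP => /nmin; rewrite ltnn.
rewrite big_map; apply: le_trans (NP n).2.
rewrite (T_split _ (M n - N n)%N) subnKC//.
apply: le_trans (leeDr _ _); last by apply: sume_ge0 => k _; exact: weight_ge0.
by rewrite (T_split _ (M n.+1 - M n)%N) subnKC ?(ltnW (MS n))// leeDl.
Qed.

Lemma sigma_narrow_null_additive h X :
  (forall f, sigma_narrow h f X) -> null_additive R X.
Proof.
move=> HX A A0.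
pose d k n : R := 2 ^- (k + n).+1 / (h (k + n)%N).+1%:R.
have d0 k n : 0 < d k n by rewrite divr_gt0// ?ltr0n// invr_gt0 exprn_gt0.
have [L LP] := choice (fun k => null_cover_blocks (d0 k) A0).
(* For every [k], [A] is covered by the blocks [L k n], and [L k n] is charged
   to the level [k + n]; [f] bounds the lengths of the finitely many blocks that
   are charged to one level. *)
pose f n := \max_(k < n.+1) \max_(s <- L k (n - k)%N) size s.
have size_f k n s : s \in L k n -> (size s <= f (k + n)%N)%N.
  move=> sL; have kn : (k < (k + n).+1)%N by rewrite ltnS leq_addr.
  apply: leq_trans (leq_bigmax (Ordinal kn)); rewrite /= addKn.
  exact: leq_bigmax_seq.
have [P XP Pnarrow] := HX f.
apply: (@null_subset _ _ (\bigcup_p cantor_sumset A (P p))).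
  move=> _ [a Aa [x /XP[p _ Px] <-]].
  by exists p => //; exists a => //; exists x.
apply: null_bigcup => p; have [m mP] := Pnarrow p.
apply: le_exp2N_null => N; pose k := maxn m N.
apply: le_trans (_ : (2 ^- k)%:E <= _)%E; last first.
  by rewrite lee_fin lef_pV2 ?posrE ?exprn_gt0// ler_weXn2l ?ler1n// leq_maxr.
have mk n : (m <= k + n)%N := leq_trans (leq_maxl m N) (leq_addr n k).
have [S SP] := choice (fun n => mP (k + n)%N (mk n)).
pose B n t := [set y | exists2 s, s \in L k n & cylinder (seq_add s t) y].
apply: le_trans (bigcup_exp2N_le (B := fun n =>
    [set y | exists2 t, t \in S n & B n t y]) _); last first.
  move=> n; apply: le_trans (cantor_measure_seq_const (c := d k n) _) _.
    move=> t _; apply: le_trans (cantor_measure_seq_sum _ _ _) _.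
    apply: le_trans ((LP k).2 n); apply: lee_sum => s _.
    apply: le_trans (cantor_measure_cylinder _ _) _.
    by rewrite /weight size_mkseq.
  rewrite lee_fin /d mulrCA ger_pMr ?invr_gt0 ?exprn_gt0//.
  by rewrite ler_pdivrMr ?ltr0n// mul1r ler_nat (leq_trans (SP n).1).
apply: le_outer_measure => _ [a Aa [x Px <-]].
have [n [s sL sa]] := (LP k).1 a Aa; exists n => //.
exists (mkseq x (f (k + n)%N)); first exact: (SP n).2.
by exists s => //; apply: cylinder_add => //; exact: size_f.
Qed.

End NarrowNullAdditive.

(** * Null-additive sets are sigma-narrow *)

Lemma exists_uniq_seq (T : eqType) (Q : set T) k :
  ~ (exists S : seq T, (size S <= k)%N /\ forall t, Q t -> t \in S) ->
  exists qs : seq T, [/\ uniq qs, size qs = k & forall t, t \in qs -> Q t].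
Proof.
elim: k => [|k IH] H; first by exists [::].
have [|qs [uqs sqs Qqs]] := IH.
  by move=> [S [Sk QS]]; apply: H; exists S; rewrite leqW.
have [t [Qt tqs]] : exists t, Q t /\ t \notin qs.
  apply: contrapT => H'; apply: H; exists qs.
  rewrite sqs leqnSn; split=> // t Qt.
  by apply: contrapT => /negP tqs; apply: H'; exists t.
exists (t :: qs); rewrite /= tqs uqs sqs; split=> // u.
by rewrite inE => /predU1P[->|/Qqs].
Qed.

Section NullAdditiveNarrow.
Variable R : realType.
Local Notation mu := (cantor_outer_measure R).
Local Notation weight := (@weight R).

Lemma pow_half n : (1 - 2 ^- n) ^+ (2 ^ n) <= 2^-1 :> R.
Proof.
have p1 : 2 ^- n <= 1 :> R by rewrite invf_le1 ?exprn_gt0// exprn_ege1// ler1n.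
apply: le_trans (_ : expR (- 2 ^- n) ^+ (2 ^ n) <= _).
  by rewrite lerXn2r ?nnegrE ?subr_ge0 ?expR_ge0// expR_ge1Dx.
rewrite -expRM_natl mulrN natrX mulfV ?lt0r_neq0 ?exprn_gt0// expRN.
rewrite lef_pV2 ?posrE ?expR_gt0//.
by have := @expR_ge1Dx R 1; rewrite -natr1.
Qed.

(** The position of the window is computed from [y] itself. Translating by
points with different restrictions to [g n] coordinates changes the position,
so that the translates of this set become independent. Here [pickle] serves as
an injective numbering of the bit strings. *)
Definition zero_block (g : nat -> nat) n : set cantor_space :=
  [set y | forall j, (j < n)%N ->
    y (g n + n * pickle (mkseq y (g n)) + j)%N = false].

Lemma zero_block_measure g n : (mu (zero_block g n) <= (2 ^- n)%:E)%E.
Proof.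
rewrite -[zero_block g n]setIT -cylinder_nil.
have -> : (2 ^- n)%:E = ((2 ^- n)%:E * weight [::] :> \bar R)%E.
  by rewrite /weight expr0 invr1 mule1.
apply: (@relative_bound _ _ _ _ (g n)) => t tn.
apply: (@relative_bound _ _ _ _ (n * pickle t)) => u un; rewrite cat0s.
apply: le_trans (_ : mu (cylinder (t ++ u ++ nseq n false)) <= _)%E.
  apply: le_outer_measure => y [yb]; rewrite catA => ytu.
  apply/cylinder_cat; split=> // j; rewrite size_nseq => jn.
  have [yt _] := (cylinder_cat _ _ _).1 ytu.
  have := yb j jn; have -> : mkseq y (g n) = t by rewrite -tn.
  by rewrite nth_nseq jn size_cat tn un.
apply: le_trans (cantor_measure_cylinder _ _) _.
by rewrite catA lee_fin (size_cat (t ++ u)) size_nseq exprD invfM mulrC.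
Qed.

(** Inside the cylinder of [p], the point [y] satisfies [y + x \in zero_block]
when its window at the address computed from [p + x] agrees with [x]. Distinct
restrictions of [x] give disjoint windows, and [E] forbids one pattern in each
of them. *)
Lemma half_density_of_avoiding g n (E X : set cantor_space) p :
  size p = g n ->
  ~ (exists S : seq (seq bool), (size S <= 2 ^ n)%N /\
       forall x, X x -> mkseq x (g n) \in S) ->
  (forall x y, X x -> E y -> ~ zero_block g n (cantor_add y x)) ->
  (mu (E `&` cylinder p) <= (2^-1)%:E * weight p)%E.
Proof.
move=> pn many avoid.
have [|qs [uqs sqs Qqs]] :=
    @exists_uniq_seq _ [set mkseq x (g n) | x in X] (2 ^ n)%N.
  move=> [S [Sn HS]]; apply: many; exists S; split=> // x Xx.
  by apply: HS; exists x.
have size_qs q : q \in qs -> size q = size p.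
  by move=> /Qqs[x _ <-]; rewrite size_mkseq pn.
pose codes := sort leq [seq pickle (seq_add p q) | q <- qs].
have sorted_codes : sorted ltn codes.
  rewrite ltn_sorted_uniq_leq sort_uniq (sort_sorted leq_total) andbT.
  rewrite map_inj_in_uniq// => q q' /size_qs qp /size_qs q'p.
  by move=> /(pcan_inj pickleK)/(seq_add_inj qp q'p).
pose addrs := [seq (g n + n * c)%N | c <- codes].
have size_addrs : size addrs = (2 ^ n)%N by rewrite size_map size_sort size_map.
have mem_addrs a : a \in addrs ->
    exists2 q, q \in qs & a = (g n + n * pickle (seq_add p q))%N.
  by move=> /mapP[c]; rewrite mem_sort => /mapP[q qq ->] ->; exists q.
have -> : E `&` cylinder p = (E `&` cylinder p) `&` cylinder p.
  by rewrite -setIA setIid.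
apply: le_trans (@relative_bound_windows _ _ n addrs _ _ _ _) _.
- rewrite sorted_map; apply: sub_sorted sorted_codes => c c' /= cc'.
  by rewrite -addnA leq_add2l -mulnSr leq_mul2l cc' orbT.
- by move=> a /mem_addrs[q _ ->]; rewrite pn leq_addr.
- move=> a /mem_addrs[q /Qqs[x Xx xq] ->]; exists x => y [Ey yp] yx.
  apply: (avoid x y) => // j jn; rewrite mkseq_cantor_add xq.
  have -> : mkseq y (g n) = p by rewrite -pn.
  by rewrite /cantor_add yx// addbb.
by rewrite size_addrs lee_wpmul2r ?weight_ge0// lee_fin pow_half.
Qed.

(** Otherwise [E] would fill at most half of every cylinder of length [g n], for
infinitely many [n]. *)
Lemma narrow_of_avoiding g (E X : set cantor_space) m :
  (forall n, (n <= g n)%N) -> mu E <> 0%E ->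
  (forall n x y, (m <= n)%N -> X x -> E y ->
    ~ zero_block g n (cantor_add y x)) ->
  narrow (expn 2) g X.
Proof.
move=> ng E0 avoid; apply: contrapT => H; apply: E0.
apply: null_of_half_density => N.
have [n [Nn many]] : exists n, (maxn m N <= n)%N /\
   ~ exists S : seq (seq bool), (size S <= 2 ^ n)%N /\
       forall x, X x -> mkseq x (g n) \in S.
  apply: contrapT => H'; apply: H; exists (maxn m N) => n mn.
  by apply: contrapT => many; apply: H'; exists n.
exists (g n) => [|p pn].
  by rewrite (leq_trans _ (ng n))// (leq_trans _ Nn)// leq_maxr.
apply: half_density_of_avoiding many _ => // x y; apply: avoid.
by rewrite (leq_trans _ Nn)// leq_maxl.
Qed.

Definition limsup_zero_block g : set cantor_space :=
  [set y | forall N, exists2 n, (N <= n)%N & zero_block g n y].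

(** For an open [U], the complement of [U] is pruned at the nodes where it is
null, so that any cylinder that meets the remaining closed set does so in
positive measure. *)
Definition heavy (U : set cantor_space) s := mu (cylinder s `\` U) != 0%E.
Definition heavy_core (U : set cantor_space) :=
  [set y | forall n, heavy U (mkseq y n)].

Lemma heavy_core_nonnull U s : heavy U s ->
  mu (heavy_core U `&` cylinder s) <> 0%E.
Proof.
move=> /eqP sU E0; apply: sU.
(* A point of [cylinder s] outside of [U] and of the core lies in one of the
   countably many cylinders that are null outside of [U]. *)
pose B t := if heavy U t then set0 else cylinder t `\` U.
apply: (@null_subset _ _ ((heavy_core U `&` cylinder s) `|` \bigcup_t B t)).
  move=> x [sx Ux]; have [xK|xK] := pselect (heavy_core U x); [by left|right].
  have [n nn] : exists n, ~ heavy U (mkseq x n) by apply/existsNP.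
  exists (mkseq x n) => //; rewrite /B; move/negP/negPf: nn => ->; split=> //.
  exact: cylinder_mkseq.
apply: null_setU => //; apply: null_bigcup => t; rewrite /B.
by case: ifPn => [_|/negPn/eqP//]; exact: outer_measure0.
Qed.

(** Baire category: otherwise, heavy strings could be extended again and again
so as to enter [x + zero_block g n] for larger and larger [n], and their limit
[z] would have [z + x] in the limsup while lying outside of [U]. *)
Lemma avoids_zero_blocks_somewhere (g : nat -> nat) (u : nat -> seq bool) x :
  let U := \bigcup_k cylinder (u k) in
  heavy U [::] ->
  (forall z, limsup_zero_block g (cantor_add z x) -> U z) ->
  exists s m, heavy U s /\ forall n y, (m <= n)%N ->
    (heavy_core U `&` cylinder s) y -> ~ zero_block g n (cantor_add y x).
Proof.
move=> U heavy_nil AU; apply: contrapT => H.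
have step (c : nat * {s | heavy U s}) : exists t : {s | heavy U s},
    [/\ prefix (sval c.2) (sval t), (size (sval c.2) < size (sval t))%N &
     exists2 n, (c.1 <= n)%N &
       forall z, cylinder (sval t) z -> zero_block g n (cantor_add z x)].
  case: c => m [s gs] /=.
  have [n [y [mn [[yK sy] yb]]]] : exists n y, (m <= n)%N /\
      (heavy_core U `&` cylinder s) y /\ zero_block g n (cantor_add y x).
    apply: contrapT => H'; apply: H; exists s, m; split=> // n y mn yE yb.
    by apply: H'; exists n, y.
  set a := (g n + n * pickle (mkseq (cantor_add y x) (g n)))%N in yb.
  (* [zero_block g n] looks at no coordinate of [y + x] beyond [l]. *)
  have [l lE] : exists l, l = (a + n + size s).+1 by eexists.
  exists (exist (fun s => is_true (heavy U s)) (mkseq y l) (yK l)); split=> /=.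
  - by apply: prefix_cylinder => //; lia.
  - by rewrite size_mkseq; lia.
  exists n => // z /cylinderP; rewrite size_mkseq => zy.
  have zyE i : (i < l)%N -> cantor_add z x i = cantor_add y x i.
    by move=> il; rewrite /cantor_add zy// nth_mkseq.
  have zyg : mkseq (cantor_add z x) (g n) = mkseq (cantor_add y x) (g n).
    apply/eq_in_map => i; rewrite mem_iota => /andP[_ ig]; apply: zyE.
    by rewrite lE /a; lia.
  move=> j jn; rewrite zyg -/a zyE ?yb//; lia.
have [next nextP] := choice step.
pose c j := iteri j (fun i t => next (i, t))
  (exist (fun s => is_true (heavy U s)) _ heavy_nil).
have cS j : c j.+1 = next (j, c j) by [].
have size_c j : (j <= size (sval (c j)))%N.
  elim: j => // j IH; rewrite cS; have [_ lt _] := nextP (j, c j).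
  exact: leq_ltn_trans lt.
have [z cz] : exists z, forall j, cylinder (sval (c j)) z.
  by apply: cylinder_chain => // j; rewrite cS; have [] := nextP (j, c j).
have [k _ zk] : U z.
  apply: AU => N; have [_ _ [n Nn nP]] := nextP (N, c N).
  by exists n => //; apply: nP; rewrite -cS; exact: cz.
have := svalP (c (size (u k))); rewrite /heavy => /eqP; apply.
rewrite (_ : _ `\` _ = set0) ?outer_measure0//; apply/seteqP; split=> // y [yc].
apply; exists k => //; apply: cylinder_prefix yc.
by rewrite -(cz (size (u k))); apply: prefix_cylinder.
Qed.

Lemma null_additive_sigma_narrow X : null_additive R X ->
  forall f, sigma_narrow (expn 2) f X.
Proof.
move=> NA f.
(* [g] is unbounded, so that bounds at the levels [g n] are bounds on cylinders
   of arbitrarily large lengths. *)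
pose g n := (f n + n)%N.
have A0 : null_ideal R (limsup_zero_block g).
  by apply: null_limsup (zero_block_measure g) _.
have : (mu (cantor_sumset (limsup_zero_block g) X) < 1%:E)%E.
  by rewrite (NA _ A0) lte_fin.
move=> /cantor_measure_lt[u Au u1]; pose U := \bigcup_k cylinder (u k).
have heavy_nil : heavy U [::].
  apply/eqP => T0; have := @cantor_measureT R; apply/negP; rewrite -ltNge.
  apply: le_lt_trans u1.
  apply: le_trans (cantor_measure_le R (@subset_refl _ U)).
  rewrite -[leRHS]adde0 -T0.
  apply: (@le_trans _ _ (mu (U `|` (cylinder [::] `\` U)))); last first.
    exact: outer_measureU2.
  apply: le_outer_measure => x _.
  by have [|] := pselect (U x); [left|right; rewrite cylinder_nil].
pose P (i : seq bool * nat) := [set x | X x /\ heavy U i.1 /\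
  forall n y, (i.2 <= n)%N ->
    (heavy_core U `&` cylinder i.1) y -> ~ zero_block g n (cantor_add y x)].
apply: (@sigma_narrow_countable _ _ _ P) => [x Xx|[s m]].
  have [|s [m [gs sm]]] := @avoids_zero_blocks_somewhere g u x heavy_nil.
    move=> z zA; apply: Au; exists (cantor_add z x) => //.
    by exists x => //; exact: cantor_addK.
  by exists (s, m).
apply: (@narrow_le _ _ g) => [n|]; first exact: leq_addr.
have [gs|ngs] := pselect (heavy U s); last first.
  by exists 0%N => n _; exists [::]; split=> // x [_ [gs]]; case: ngs.
apply: (@narrow_of_avoiding _ _ _ m _ (heavy_core_nonnull gs)).
  by move=> n; exact: leq_addl.
move=> n x y mn [_ [_ xP]] yE.
exact: (xP n y).
Qed.

End NullAdditiveNarrow.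

(** * Sets of minimal cardinality *)

(** Consider sets of choice functions on [F] of which any two differ at each
member of [F]. When such a set is maximal, its values exhaust some member [A]
of [F], since otherwise a function could be added that takes a new value
everywhere. Then [A] injects into any [B] in [F] by sending the value at [A]
to the value at [B] of the same function. *)
Lemma exists_min_card T (F : set (set T)) : F !=set0 ->
  exists A, is_min_card F A.
Proof.
move=> [A0 FA0].
pose P (M : set (set T -> T)) := (forall phi B, M phi -> F B -> B (phi B)) /\
  forall phi psi B, M phi -> M psi -> F B -> phi B = psi B -> phi = psi.
have [|M [[Msel Minj] Mmax]] := @Zorn_bigcup (set T -> T) P.
  move=> C CP tot.
  split=> [phi B [M CM Mphi]|phi psi B [M CM Mphi] [N CN Npsi]].
    by have [sel _] := CP M CM; exact: sel.
  have [_ Minj] := CP M CM; have [_ Ninj] := CP N CN.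
  have [MN|NM] := tot M N CM CN; first by apply: Ninj => //; exact: MN.
  by apply: Minj => //; exact: NM.
have [A FA AM] : exists2 A, F A &
    forall a, A a -> exists2 phi, M phi & phi A = a.
  apply: contrapT => H.
  have fresh B : F B -> exists b, B b /\ forall phi, M phi -> phi B <> b.
    move=> FB; apply: contrapT => H'; apply: H; exists B => // b Bb.
    apply: contrapT => H''; apply: H'; exists b; split=> // phi Mphi phib.
    by apply: H''; exists phi.
  have [b0 _] := fresh A0 FA0.
  have fresh' B : exists b, F B -> B b /\ forall phi, M phi -> phi B <> b.
    have [/fresh[b]|nFB] := pselect (F B); first by exists b.
    by exists b0.
  have [psi psiP] := choice fresh'.
  apply: (Mmax (M `|` [set psi])).
    split=> [|/(_ psi (or_intror erefl)) Mpsi]; first exact: subsetUl.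
    by have [_ /(_ psi Mpsi)] := psiP A0 FA0.
  split=> [phi B [Mphi|->] FB|phi phi' B].
  - exact: (Msel phi B).
  - by have [] := psiP B FB.
  - move=> [Mphi|->] [Mphi'|->] // FB.
    + exact: Minj.
    + by have [_ npsi] := psiP B FB => /npsi.
    + by have [_ npsi] := psiP B FB => /esym /npsi.
exists A; split=> // B FB.
have point (b : T) : exists a, forall phi, M phi -> phi B = b -> phi A = a.
  have [[phi Mphi phib]|none] := pselect (exists2 phi, M phi & phi B = b).
    exists (phi A) => psi Mpsi psib; congr (_ A).
    by apply: (Minj _ _ B) => //; rewrite psib.
  by exists b => phi Mphi phib; case: none; exists phi.
have [g gP] := choice point.
apply: card_le_trans (card_image_le g B).
apply: subset_card_le => a /AM[phi Mphi <-].
by exists (phi B); [exact: (Msel phi B)|rewrite (gP (phi B) phi)].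
Qed.

(** * Unions of few null-additive sets *)

(** All the pieces of a set are coded at once by a single point, so that a
family of sets has at most as many codes as members. *)
Definition tree_code (P : nat -> set cantor_space) : cantor_space :=
  fun i => if unpickle i is Some (p, s)
    then `[< P p `&` cylinder s !=set0 >] else false.

Definition code_determines f g := forall P Q n p, (p <= n)%N ->
  mkseq (tree_code P) (g n) = mkseq (tree_code Q) (g n) ->
  forall x, P p x -> exists2 y, Q p y & mkseq y (f n) = mkseq x (f n).

Lemma exists_code_determines f : exists g, code_determines f g.
Proof.
exists (fun n => (\max_(p < n.+1) \max_(t : (f n).-tuple bool)
  pickle (val p, val t)).+1) => P Q n p pn.
set l := _.+1 => eqPQ x Px.
have st : size (mkseq x (f n)) == f n by rewrite size_mkseq.
pose i := pickle (p, mkseq x (f n)).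
have il : (i < l)%N.
  rewrite ltnS; apply: leq_trans (leq_bigmax (Ordinal (pn : (p < n.+1)%N))).
  exact: (leq_bigmax (Tuple st)).
have := congr1 (fun s => nth false s i) eqPQ; rewrite !nth_mkseq//.
rewrite /tree_code /i pickleK asboolT; last first.
  by exists x; split=> //; exact: cylinder_mkseq.
move=> /esym/asboolP[y [Qy]]; rewrite /cylinder /= size_mkseq => yx.
by exists y.
Qed.

(** There are at most [h n] codes up to [g n] bits, and each of them allows
[h n] restrictions. *)
Lemma bigcup_sigma_narrow h f g (K : set (set cantor_space))
    (P : set cantor_space -> nat -> set cantor_space) :
  code_determines f g ->
  (forall X, K X -> X `<=` \bigcup_p P X p /\ forall p, narrow h f (P X p)) ->
  sigma_narrow h g ((fun X => tree_code (P X)) @` K) ->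
  sigma_narrow (fun n => h n * h n)%N f (\bigcup_(X in K) X).
Proof.
move=> gP KP [C KC Cn].
pose bounded X p m := forall n, (m <= n)%N -> exists S : seq (seq bool),
    (size S <= h n)%N /\ forall x, P X p x -> mkseq x (f n) \in S.
(* A piece is given by a piece of the set of codes, the index of a tree, and a
   rank from which this tree is narrow. *)
pose D (i : nat * nat * nat) := [set x | exists X,
  [/\ K X, C i.1.1 (tree_code (P X)), bounded X i.1.2 i.2 & P X i.1.2 x]].
apply: (@sigma_narrow_countable _ _ _ D) => [x [X KX Xx]|[[q p] m]].
  have [/(_ x Xx)[p _ Px] /(_ p)[m mP]] := KP X KX.
  have [q _ Cq] := KC _ (imageP _ KX).
  by exists (q, p, m) => //; exists X.
have [mq mqP] := Cn q; exists (maxn mq (maxn p m)) => n.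
rewrite !geq_max => /and3P[/mqP[S [Sn SC]] pn mn].
have lists (s : seq bool) : exists L : seq (seq bool), (size L <= h n)%N /\
    forall X x, K X -> bounded X p m -> mkseq (tree_code (P X)) (g n) = s ->
      P X p x -> mkseq x (f n) \in L.
  have [[X [bX Xs]]|none] := pselect (exists X,
      bounded X p m /\ mkseq (tree_code (P X)) (g n) = s); last first.
    by exists [::]; split=> // X x KX bX Xs; case: none; exists X.
  have [L [Ln LX]] := bX n mn; exists L; split=> // Y y _ _ Ys.
  move=> /(gP (P Y) (P X) n p pn)[|z Pz <-]; first by rewrite Ys.
  exact: LX.
have [L LP] := choice lists.
exists (flatten [seq L s | s <- S]); split.
  rewrite size_flatten /shape -map_comp.
  apply: leq_trans (_ : size S * h n <= _)%N.
    elim: {Sn SC} S => //= s S IH; rewrite mulSn leq_add//; exact: (LP s).1.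
  by rewrite leq_mul2r Sn orbT.
move=> x [X [/= KX CX bX Px]].
apply/flattenP; exists (L (mkseq (tree_code (P X)) (g n))).
  by apply: map_f; exact: SC.
exact: (LP _).2 Px.
Qed.

Section UnionsOfFew.
Variable R : realType.
Local Notation weight := (@weight R).

Lemma null_additive1 x : null_additive R [set x].
Proof.
apply: (@sigma_narrow_null_additive _ (fun=> 1%N)) => f.
exists (fun=> [set x]) => [y ->|_]; first by exists 0%N.
exists 0%N => n _; exists [:: mkseq x (f n)]; split=> // y ->.
exact: mem_head.
Qed.

Lemma not_null_additiveT : ~ null_additive R setT.
Proof.
have zero0 : null_ideal R [set (fun=> false)].
  apply: le_exp2N_null => n.
  apply: le_trans (_ : weight (nseq n false) <= _)%E; last first.
    by rewrite /weight size_nseq.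
  apply: le_trans (cantor_measure_cylinder _ _).
  apply: le_outer_measure => _ ->.
  apply/cylinderP => i; rewrite size_nseq => il.
  by rewrite nth_nseq il.
move=> /(_ _ zero0) T0; have := cantor_measureT R.
rewrite (_ : setT = cantor_sumset [set (fun=> false)] setT); last first.
  by apply/seteqP; split=> // x _; exists (fun=> false) => //; exists x.
by rewrite T0 lee_fin ler10.
Qed.

Lemma non_le_add (K : set (set cantor_space)) (A : set cantor_space) :
  is_non (null_additive R) A -> K `<=` null_additive R ->
  ~ null_additive R (\bigcup_(X in K) X) -> (A #<= K)%card.
Proof.
move=> [_ Amin] KNA UK; apply: contrapT => AK; apply: UK.
apply: (@sigma_narrow_null_additive _ (fun n => 2 ^ n * 2 ^ n)%N) => f.
have pieces X : exists P : nat -> set cantor_space, K X ->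
    X `<=` \bigcup_p P p /\ forall p, narrow (expn 2) f (P p).
  have [/KNA/null_additive_sigma_narrow/(_ f)[P XP Pn]|nKX] := pselect (K X).
    by exists P.
  by exists (fun=> set0) => /nKX.
have [P PP] := choice pieces.
have [g gP] := exists_code_determines f.
apply: bigcup_sigma_narrow gP PP _; apply: (@null_additive_sigma_narrow R).
apply: contrapT => codes; apply: AK; apply: card_le_trans (Amin _ codes) _.
exact: card_image_le.
Qed.

End UnionsOfFew.

Theorem theoremA (R : realType) :
  exists (J : set (set cantor_space)) (A : set cantor_space),
    is_add (null_additive R) J /\ is_non (null_additive R) A /\
    (J #= A)%card.
Proof.
have [|A Anon] := @exists_min_card _ [set B | ~ null_additive R B].
  by exists setT; exact: not_null_additiveT.
pose J := [set [set x] | x in A]; exists J, A.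
have JA : (J #= A)%card.
  by apply: inj_card_eq => x y _ _ /seteqP[/(_ x erefl)].
split; last by split.
split=> [|K [KNA UK]].
  split=> [_ [x _ <-]|]; first exact: null_additive1.
  rewrite (_ : \bigcup_(X in J) X = A); first by case: Anon.
  apply/seteqP; split=> [x [_ [y Ay <-] ->]//|x Ax].
  by exists [set x] => //; exists x.
by rewrite (card_le_eql JA); exact: non_le_add Anon KNA UK.
Qed.
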